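(* Let $\mathbb{V}$ be a Lie algebra with bracket $\{\cdot,\cdot\}$ and let $\mathbb{B}\subset\mathbb{V}$ be a Lie subalgebra. Let $\mathcal{H}\in\operatorname{der}\mathbb{V}$ be a (not necessarily inner) derivation such that (i) $\mathcal{H}\mathbb{B}\subseteq\mathbb{B}$. Let $V\in\mathbb{V}$ be such that $\{V\}\mathbb{B}\not\subseteq\mathbb{B}$. Assume there are (linear) operators $\mathcal{R}\colon\mathbb{V}\to\mathbb{B}$ and $\Gamma\colon\mathbb{V}\to\operatorname{der}\mathbb{V}$ such that (ii) $\mathcal{R}^2=\mathcal{R}$; (iii) $[\mathcal{H}](\Gamma F)=\{\mathcal{N}F\}$ for all $F\in\mathbb{V}$, where $\mathcal{N}:=1-\mathcal{R}$. Then $$e^{[\Gamma V]}\big(\mathcal{H}+\{V\}\big)=\mathcal{H}_*+\{V_*\},\qquad \mathcal{H}_*:=\mathcal{H}+\{\mathcal{R}V\},$$ where $V_*$ is a (formal) series in $V$ all of whose terms are of order quadratic or higher in $V$.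
   Context: The Lie algebra is over a field $\mathbb{K}$ in which the factorials $n!$ are invertible (e.g. $\mathbb{R}$ or $\mathbb{C}$). $\operatorname{der}\mathbb{V}$ is the space of linear maps $\mathcal{D}\colon\mathbb{V}\to\mathbb{V}$ with $\mathcal{D}\{F,G\}=\{\mathcal{D}F,G\}+\{F,\mathcal{D}G\}$; it is a Lie algebra under the commutator $[\mathcal{F},\mathcal{G}]=\mathcal{F}\mathcal{G}-\mathcal{G}\mathcal{F}$. For $F\in\mathbb{V}$, $\{F\}$ denotes the inner derivation $G\mapsto\{F,G\}$. For $\mathcal{F}\in\operatorname{der}\mathbb{V}$, $[\mathcal{F}]$ denotes the map $\mathcal{G}\mapsto[\mathcal{F},\mathcal{G}]$ on $\operatorname{der}\mathbb{V}$. The exponential is the Lie series $e^{\mathcal{A}}=\sum_{n\ge0}\mathcal{A}^n/n!$, understood here as a formal series graded by the number of occurrences of $V$. Precisely: replacing $V$ by $\lambda V$ with a formal parameter $\lambda$ (so $\Gamma V$ becomes $\lambda\,\Gamma V$), the assertion is that there is $V_*(\lambda)\in\lambda^2\,\mathbb{V}[[\lambda]]$ such that $e^{\lambda[\Gamma V]}(\mathcal{H}+\lambda\{V\})=\mathcal{H}+\lambda\{\mathcal{R}V\}+\{V_*(\lambda)\}$ as formal power series in $\lambda$ with coefficients in $\operatorname{der}\mathbb{V}$, where each coefficient of $V_*(\lambda)$ is obtained from $V$ by means of $\Gamma V$ and $\mathcal{N}$. *)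

(* Defs.v *)
From HB Require Import structures.
From mathcomp Require Import all_boot all_order all_algebra.
From mathcomp Require Import boolp classical_sets functions.

Set Implicit Arguments.
Unset Strict Implicit.
Unset Printing Implicit Defensive.

Import GRing.Theory.

Local Open Scope classical_set_scope.
Local Open Scope ring_scope.

HB.mixin Record Lmodule_isLieAlgebra (K : fieldType) (V : Type)
    of GRing.Lmodule K V := {
  bracket : V -> V -> V;
  bracket_linearl : forall G, linear (fun F => bracket F G);
  bracket_linearr : forall F, linear (bracket F);
  bracket_alt : forall F, bracket F F = 0;
  bracket_jacobi : forall F G H,
    bracket F (bracket G H) + bracket G (bracket H F) + bracket H (bracket F G)
      = 0
}.

#[short(type="lieAlgType")]
HB.structure Definition LieAlgebra (K : fieldType) :=
  {V of Lmodule_isLieAlgebra K V & GRing.Lmodule K V}.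

Notation "{[ F , G ]}" := (bracket F G) (at level 0, format "{[ F ,  G ]}").

Definition ad (K : fieldType) (V : lieAlgType K) (F : V) : V -> V :=
  fun G => {[F, G]}.

Definition lie_subalgebra (K : fieldType) (V : lieAlgType K) (B : set V) :=
  [/\ B 0,
      forall (a : K) F G, B F -> B G -> B (a *: F + G)
    & forall F G, B F -> B G -> B {[F, G]}].

Section BracketTheory.
Variables (K : fieldType) (V : lieAlgType K).
Implicit Types F G H : V.

Lemma bracketDl F G H : {[F + G, H]} = {[F, H]} + {[G, H]}.
Proof.
by have := bracket_linearl H 1 F G; rewrite /= !scale1r.
Qed.

Lemma bracketDr F G H : {[F, G + H]} = {[F, G]} + {[F, H]}.
Proof. by have := bracket_linearr F 1 G H; rewrite !scale1r. Qed.

Lemma bracket0l G : {[0, G]} = 0 :> V.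
Proof. by apply: (@addrI _ {[0, G]}); rewrite -bracketDl !addr0. Qed.

Lemma bracket0r G : {[G, 0]} = 0 :> V.
Proof. by apply: (@addrI _ {[G, 0]}); rewrite -bracketDr !addr0. Qed.

Lemma bracketZl a F G : {[a *: F, G]} = a *: {[F, G]}.
Proof.
by have := bracket_linearl G a F 0; rewrite /= bracket0l !addr0.
Qed.

Lemma bracketZr a F G : {[F, a *: G]} = a *: {[F, G]}.
Proof. by have := bracket_linearr F a G 0; rewrite bracket0r !addr0. Qed.

Lemma bracketC F G : {[F, G]} = - {[G, F]}.
Proof.
have := bracket_alt (F + G).
rewrite bracketDl !bracketDr !bracket_alt add0r addr0 => /eqP.
by rewrite addr_eq0 => /eqP.
Qed.

Lemma bracketNr F G : {[F, - G]} = - {[F, G]}.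
Proof. by rewrite -scaleN1r bracketZr scaleN1r. Qed.

Lemma bracketNl F G : {[- F, G]} = - {[F, G]}.
Proof. by rewrite -scaleN1r bracketZl scaleN1r. Qed.

End BracketTheory.

Section Derivations.
Variables (K : fieldType) (V : lieAlgType K).

Definition is_derivation (D : V -> V) : Prop :=
  linear D /\ forall F G, D {[F, G]} = {[D F, G]} + {[F, D G]}.

Definition derivation_pred : pred (V -> V) := fun D => `[< is_derivation D >].

Lemma derivation_submod : subsemimod_closed derivation_pred.
Proof.
have D0 (D : V -> V) : linear D -> D 0 = 0.
  by move=> lD; have := lD (-1) 0 0; rewrite scaleN1r addNr scaleN1r addNr.
split; first split.
- apply/asboolP; split=> [a F G|F G]; rewrite /GRing.zero /=.
    by rewrite scaler0 addr0.
  by rewrite bracket0l bracket0r addr0.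
- move=> D E /asboolP[lD dD] /asboolP[lE dE]; apply/asboolP; split.
    by move=> a F G; rewrite !fctE lD lE scalerDr addrACA.
  by move=> F G; rewrite !fctE dD dE bracketDl bracketDr addrACA.
- move=> a D /asboolP[lD dD]; apply/asboolP; split.
    move=> b F G; rewrite !fctE lD scalerDr !scalerA.
    by rewrite [a * b]mulrC.
  by move=> F G; rewrite !fctE dD bracketZl bracketZr scalerDr.
Qed.

HB.instance Definition _ :=
  GRing.isSubmodClosed.Build K (V -> V) derivation_pred derivation_submod.

Record der := Der { der_fun :> V -> V; der_funP : derivation_pred der_fun }.

HB.instance Definition _ := [isSub for der_fun].
HB.instance Definition _ := [Choice of der by <:].
HB.instance Definition _ := [SubChoice_isSubLmodule of der by <:].

Lemma derivationP (D : der) : is_derivation D.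
Proof. exact/asboolP/der_funP. Qed.

Lemma derP (D E : der) : D =1 E -> D = E.
Proof. by move=> DE; apply: val_inj; apply/funext. Qed.

HB.instance Definition _ (D : der) :=
  GRing.isLinear.Build K V V *:%R (der_fun D) (derivationP D).1.

Lemma der_linear (D : der) (a : K) F G : D (a *: F + G) = a *: D F + D G.
Proof. exact: (derivationP D).1. Qed.

Lemma derD (D : der) F G : D (F + G) = D F + D G.
Proof. exact: raddfD. Qed.

Lemma derB (D : der) F G : D (F - G) = D F - D G.
Proof. exact: raddfB. Qed.

Lemma der_bracket (D : der) F G : D {[F, G]} = {[D F, G]} + {[F, D G]}.
Proof. exact: (derivationP D).2. Qed.

Lemma commutator_subproof (D E : der) :
  derivation_pred (fun F => D (E F) - E (D F)).
Proof.
apply/asboolP; split=> [a F G|F G].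
  by rewrite !der_linear scalerBr opprD addrACA.
rewrite !der_bracket !derD !der_bracket !bracketDl !bracketDr !bracketNl !bracketNr.
rewrite (addrACA {[D (E F), G]}) opprD.
rewrite [in LHS](addrACA ({[D (E F), G]} + _)); congr (_ + _).
  by rewrite [{[E (D F), G]} + _]addrC addrKA.
by rewrite [X in X - _ = _]addrC addrKA.
Qed.

Definition commutator (D E : der) : der := Der (commutator_subproof D E).

Lemma commutatorE D E F : commutator D E F = D (E F) - E (D F).
Proof. by []. Qed.

Lemma derDE (D E : der) F : (D + E) F = D F + E F.
Proof. by []. Qed.

Lemma derZE a (D : der) F : (a *: D) F = a *: D F.
Proof. by []. Qed.

Lemma commutator_linearl (E : der) : linear (fun D => commutator D E).
Proof.
move=> a D D'; apply: derP => F.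
by rewrite derDE derZE !commutatorE ?derDE ?derZE ?der_linear scalerBr opprD addrACA.
Qed.

Lemma commutator_linearr (D : der) : linear (commutator D).
Proof.
move=> a E E'; apply: derP => F.
by rewrite derDE derZE !commutatorE ?derDE ?derZE ?der_linear scalerBr opprD addrACA.
Qed.

Lemma commutator_alt (D : der) : commutator D D = 0.
Proof. by apply: derP => F; rewrite commutatorE subrr. Qed.

Lemma commutator_jacobi (D E G : der) :
  commutator D (commutator E G) + commutator E (commutator G D)
    + commutator G (commutator D E) = 0.
Proof.
have aux (W : zmodType) (a b c d e f : W) :
    a - b - (c - d) + (c - e - (f - b)) + (f - d - (a - e)) = 0.
  have t (x y z : W) : x - y + (y - z) = x - z by rewrite addrA subrK.
  rewrite !opprB (addrC (c - e)) (addrACA (a - b)) !t.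
  by rewrite (addrC (f - d)) addrACA (addrC (a - f)) (addrC (d - e)) !t subrr.
by apply: derP => F; rewrite !derDE !commutatorE !derB aux.
Qed.

HB.instance Definition _ := Lmodule_isLieAlgebra.Build K der
  commutator_linearl commutator_linearr commutator_alt commutator_jacobi.

Lemma inner_subproof (F : V) : derivation_pred (ad F).
Proof.
apply/asboolP; split=> [|G H]; first exact: bracket_linearr.
have := bracket_jacobi F G H.
rewrite [{[H, F]}]bracketC bracketNr [{[H, _]}]bracketC => /subr0_eq <-.
by rewrite subrK.
Qed.

Definition inner (F : V) : der := Der (inner_subproof F).

End Derivations.

(* A formal power series \sum_n s_n lambda^n is its coefficient sequence s;    *)
(* sums and K-multiples of series are those of functions.                     *)
Notation fps X := (nat -> X) (only parsing).

Section FormalSeries.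
Variables (K : fieldType) (X : lmodType K).

Definition fps_monomial (k : nat) (x : X) : fps X :=
  fun n => if n == k then x else 0.

Definition fps_mul_lambda (s : fps X) : fps X :=
  fun n => if n is m.+1 then s m else 0.

Definition lambda_op (A : X -> X) : fps X -> fps X :=
  fun s => fps_mul_lambda (A \o s).

(* This is \sum_k A^k / k! only when A is divisible by lambda, as lambda_op _  *)
(* is: the coefficient of lambda^n in A^k s then vanishes for k > n.          *)
Definition fps_exp (A : fps X -> fps X) : fps X -> fps X :=
  fun s n => \sum_(k < n.+1) (k`!%:R : K)^-1 *: iter k A s n.

End FormalSeries.

(* The elements obtained from v by means of the operators D and N, graded by  *)
(* the number of occurrences of v when D itself is of order one in v (as is   *)
(* Gamma v, for Gamma linear).                                                *)
Inductive obtained_from (K : fieldType) (V : lmodType K) (D N : V -> V)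
    (v : V) : nat -> V -> Prop :=
  | obtained_base : obtained_from D N v 1 v
  | obtained_zero n : obtained_from D N v n 0
  | obtained_lin n (a : K) F G :
      obtained_from D N v n F -> obtained_from D N v n G ->
      obtained_from D N v n (a *: F + G)
  | obtained_N n F :
      obtained_from D N v n F -> obtained_from D N v n (N F)
  | obtained_D n F :
      obtained_from D N v n F -> obtained_from D N v n.+1 (D F).

(* Main.v *)
Require Import Defs.
From HB Require Import structures.
From mathcomp Require Import all_boot all_order all_algebra.
From mathcomp Require Import boolp classical_sets functions.

Set Implicit Arguments.
Unset Strict Implicit.
Unset Printing Implicit Defensive.

Import GRing.Theory.

Local Open Scope classical_set_scope.
Local Open Scope ring_scope.

(** Write D for Gamma v and [D] for the commutator with D.  The coefficient of
    lambda^n in the exponential is the sum over k of [D]^k / k! applied to the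
    coefficient of lambda^(n-k) in H + lambda {v}.  That series has only two
    nonzero coefficients, so for each n at most two terms survive:
      - H when n = 0;
      - [D]^n {v} / n! + [D]^(n+1) H / (n+1)! at lambda^(n+1).
    Both terms of the second kind are inner derivations.  A derivation acts on
    inner ones by [D]{F} = {D F}, hence [D]^n {v} = {D^n v}; and the
    homological equation [H]D = {N v} gives [D]H = - {N v}, hence
    [D]^(n+1) H = - {D^n (N v)}.  The coefficient of lambda^(n+1) is therefore
    the inner derivation of
    D^n (v / n! - N v / (n+1)!), obtained from v by applying N at most once and
    D exactly n times.  For n = 0 it is v - N v = R v, the first order term of
    the normal form; all the remaining terms make up V_*. *)

Section FormalExponential.
Variables (K : fieldType) (X : lmodType K).
Implicit Types (A : X -> X) (s : nat -> X).

(** Each application of lambda A shifts the coefficients by one place; A must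
    fix 0 for the places left empty to stay 0. *)
Lemma iter_lambda_op A s k n : A 0 = 0 ->
  iter k (lambda_op A) s n = if (k <= n)%N then iter k A (s (n - k)%N) else 0.
Proof.
move=> A0; elim: k n => [|k IHk] n; first by rewrite subn0.
case: n => [|n] //=.
by rewrite /lambda_op /= IHk ltnS subSS; case: ifP.
Qed.

Lemma fps_exp_lambda_opE A s n : A 0 = 0 ->
  fps_exp (lambda_op A) s n =
    \sum_(k < n.+1) (k`!%:R : K)^-1 *: iter k A (s (n - k)%N).
Proof.
by move=> A0; apply: eq_bigr => k _; rewrite iter_lambda_op // -ltnS ltn_ord.
Qed.

Lemma iter_fix0 A k : A 0 = 0 -> iter k A 0 = 0.
Proof. by move=> A0; elim: k => //= k ->. Qed.

Lemma fps_exp_lambda_op_affine0 A x y : A 0 = 0 ->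
  fps_exp (lambda_op A) (fps_monomial 0 x + fps_monomial 1 y) 0 = x.
Proof.
by move=> A0; rewrite fps_exp_lambda_opE // big_ord1 /= invr1 scale1r fctE addr0.
Qed.

Lemma fps_exp_lambda_op_affineS A x y n : A 0 = 0 ->
  fps_exp (lambda_op A) (fps_monomial 0 x + fps_monomial 1 y) n.+1 =
    (n`!%:R : K)^-1 *: iter n A y + (n.+1`!%:R : K)^-1 *: iter n.+1 A x.
Proof.
move=> A0; rewrite fps_exp_lambda_opE // !big_ord_recr [LHS]/=.
(* the index n.+1 - k is at least 2 for k < n, outside the support *)
rewrite big1 => [|k _].
  rewrite add0r subnn subSnn.
  by rewrite !fctE /fps_monomial /= add0r addr0.
rewrite !fctE /fps_monomial.
have -> : (n.+1 - k)%N = (n - k).-1.+2 by rewrite subSn ?prednK ?subn_gt0 // ltnW.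
by rewrite addr0 iter_fix0 // scaler0.
Qed.

End FormalExponential.

Section InnerDerivations.
Variables (K : fieldType) (V : lieAlgType K).
Implicit Types (F G : V) (D H : der V).

Lemma inner_linear : linear (@inner K V).
Proof. by move=> a F G; apply: derP => x; apply: bracket_linearl. Qed.

HB.instance Definition _ :=
  GRing.isLinear.Build K V (der V) *:%R (@inner K V) inner_linear.

(** This is the Leibniz rule of D, read as an identity between operators. *)
Lemma ad_inner D F : ad D (inner F) = inner (D F).
Proof.
apply: derP => G; rewrite [LHS]commutatorE.
by rewrite [D _]der_bracket addrK.
Qed.

Lemma iter_ad_inner D F n : iter n (ad D) (inner F) = inner (iter n D F).
Proof. by elim: n => //= n ->; rewrite ad_inner. Qed.

(** Once [H]D is inner, every [D]^n H with n > 0 is inner, although H itself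
    need not be: the first commutator turns H into an inner derivation, on
    which the others act through D. *)
Lemma iterS_ad_of_inner D H G n :
  ad H D = inner G -> iter n.+1 (ad D) H = - inner (iter n D G).
Proof.
move=> HD; rewrite iterSr [ad D H]bracketC -/(ad H D) HD -raddfN iter_ad_inner.
by rewrite -raddfN; congr inner; elim: n => //= n ->; rewrite raddfN.
Qed.

End InnerDerivations.

Lemma obtained_iter (K : fieldType) (V : lmodType K) (D N : V -> V) (v F : V)
    (m n : nat) :
  obtained_from D N v m F -> obtained_from D N v (n + m)%N (iter n D F).
Proof. by move=> obF; elim: n => //= n; apply: obtained_D. Qed.

(** The factorials differ by one step because N v already stands for one
    commutator with D, through [D]H = - {N v}. *)
Definition normal_form_term (K : fieldType) (V : lmodType K) (D N : V -> V)
    (v : V) (n : nat) : V :=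
  iter n D ((n`!%:R : K)^-1 *: v - (n.+1`!%:R : K)^-1 *: N v).

Lemma obtained_normal_form_term (K : fieldType) (V : lmodType K)
    (D N : V -> V) (v : V) (n : nat) :
  obtained_from D N v n.+1 (normal_form_term D N v n).
Proof.
rewrite -addn1; apply: obtained_iter; apply: obtained_lin.
  exact: obtained_base.
rewrite -scaleNr -[_ *: _]addr0; apply: obtained_lin; last exact: obtained_zero.
by apply: obtained_N; apply: obtained_base.
Qed.

(** The commutators falling on {v} and those falling on H both end in inner
    derivations, the second family one commutator later because of
    [H]D = {N v}; this is how the two families meet in one power of lambda. *)
Lemma fps_exp_normal_form (K : fieldType) (V : lieAlgType K) (H D : der V)
    (N : V -> V) (v : V) (n : nat) :
  ad H D = inner (N v) ->
  fps_exp (lambda_op (ad D)) (fps_monomial 0 H + fps_monomial 1 (inner v)) n.+1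
    = inner (normal_form_term D N v n).
Proof.
move=> HD; rewrite fps_exp_lambda_op_affineS; last exact: bracket0r.
rewrite iter_ad_inner (iterS_ad_of_inner n HD) scalerN -!linearZ -linearB /=.
congr inner; rewrite /normal_form_term.
have iterZB a b F G :
    iter n D (a *: F - b *: G) = a *: iter n D F - b *: iter n D G.
  by elim: n => //= m ->; rewrite linearB !linearZ.
by rewrite iterZB.
Qed.

Theorem proposition1 (K : fieldType)
    (hK : forall n : nat, n`!%:R \is a @GRing.unit K)
    (V : lieAlgType K) (B : set V) (hB : lie_subalgebra B)
    (H : der V) (hH : H @` B `<=` B)
    (v : V) (hv : ~ (inner v @` B `<=` B))
    (R : {linear V -> V}) (hRB : range R `<=` B)
    (Gamma : {linear V -> der V})
    (hR : R \o R = R)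
    (N : V -> V) (hN : N = idfun \- R)
    (hGamma : forall F : V, ad H (Gamma F) = inner (N F)) :
  exists Vs : fps V,
    [/\ forall n, (n < 2)%N -> Vs n = 0,
        forall n, obtained_from (Gamma v) N v n (Vs n)
      & fps_exp (lambda_op (ad (Gamma v)))
          (fps_monomial 0 H + fps_monomial 1 (inner v))
        = fps_monomial 0 H + fps_monomial 1 (inner (R v))
          + (fun n => inner (Vs n))].
Proof.
exists (fun n => if n is m.+2 then normal_form_term (Gamma v) N v m.+1 else 0).
split=> [[|[|n]] // | [|[|n]] |].
- exact: obtained_zero.
- exact: obtained_zero.
- exact: obtained_normal_form_term.
apply/funext => -[|n].
  rewrite fps_exp_lambda_op_affine0; last exact: bracket0r.
  by rewrite !fctE /fps_monomial /= raddf0 !addr0.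
rewrite (fps_exp_normal_form n (hGamma v)) !fctE /fps_monomial /= add0r.
case: n => [|n]; last by rewrite add0r.
(* the first order term is v - N v = R v *)
rewrite raddf0 addr0 /normal_form_term /= !invr1 !scale1r hN /=.
by congr inner; rewrite opprB addrC subrK.
Qed.
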